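(* Let $A$ be an integral domain and let $Y,Z$ be nonempty subsets of $\mathrm{Spec}(A)$. Then the following conditions are equivalent. (i) $s_Y$ and $s_Z$ are weakly equivalent, i.e. $\widetilde{s_Y}=\widetilde{s_Z}$. (ii) $\mathrm{Ad}^{\mathrm i}(Y)=\mathrm{Ad}^{\mathrm i}(Z)$, that is, $Y$ and $Z$ have the same closure with respect to the inverse topology of $\mathrm{Spec}(A)$. (iii) For every finitely generated ideal $\mathfrak a$ of $A$, with $D(\mathfrak a):=\{\mathfrak p\in\mathrm{Spec}(A):\mathfrak a\not\subseteq\mathfrak p\}$, one has $Y\subseteq D(\mathfrak a)$ if and only if $Z\subseteq D(\mathfrak a)$.
   Context: Let $A$ be an integral domain with quotient field $K$, and let $\overline{\mathbf F}(A)$ be the set of all nonzero $A$-submodules of $K$. A semistar operation on $A$ is a map $\star:\overline{\mathbf F}(A)\to\overline{\mathbf F}(A)$, $F\mapsto F^\star$, such that for all nonzero $k\in K$ and all $F,G\in\overline{\mathbf F}(A)$: $(kF)^\star=kF^\star$; $F\subseteq G$ implies $F^\star\subseteq G^\star$; $F\subseteq F^\star$; $(F^\star)^\star=F^\star$. For a nonempty $Y\subseteq\mathrm{Spec}(A)$, $s_Y$ is the semistar operation $F\mapsto F^{s_Y}:=\bigcap_{\mathfrak p\in Y}FA_{\mathfrak p}$. For a semistar operation $\star$, its stable closure $\widetilde\star$ is the semistar operation defined by $F^{\widetilde\star}:=\bigcup\{(F:\mathfrak a):\mathfrak a\text{ a nonzero finitely generated ideal of }A\text{ with }\mathfrak a^\star=A^\star\}$,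 where $(F:\mathfrak a):=\{x\in K:x\mathfrak a\subseteq F\}$. Two semistar operations $\star_1,\star_2$ on $A$ are weakly equivalent if $\widetilde{\star_1}=\widetilde{\star_2}$. The inverse topology on $\mathrm{Spec}(A)$ is the topology having as a basis of closed sets the collection of all subsets of $\mathrm{Spec}(A)$ that are open and compact in the Zariski topology (compact: every open cover has a finite subcover). $\mathrm{Ad}^{\mathrm i}(Y)$ denotes the closure of $Y$ in the inverse topology. *)

(* Defs.v *)
From HB Require Import structures.
From mathcomp Require Import all_boot all_order all_algebra.
From mathcomp Require Import all_classical topology.

Set Implicit Arguments.
Unset Strict Implicit.
Unset Printing Implicit Defensive.

Import GRing.Theory.
Local Open Scope ring_scope.
Local Open Scope classical_set_scope.

Section Ideals.
Variable A : idomainType.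

(* The [idealr_closed] of ring_quotient includes properness, whereas [A] itself
   is an ideal here. *)
Definition is_ideal (I : set A) :=
  [/\ I 0, forall x y, I x -> I y -> I (x + y) & forall a x, I x -> I (a * x)].

Definition ideal_gen (s : seq A) : set A :=
  [set x | exists c : 'I_(size s) -> A, x = \sum_(i < size s) c i * s`_i].

Definition fg_ideal (I : set A) := exists s : seq A, I = ideal_gen s.

Record nzideal := NzIdeal {
  nzideal_set :> set A;
  nzideal_ideal : is_ideal nzideal_set;
  nzideal_neq0 : exists2 x, nzideal_set x & x != 0 }.

Lemma ideal_gen_ideal s : is_ideal (ideal_gen s).
Proof.
split.
- by exists (fun=> 0); rewrite big1 // => i _; rewrite mul0r.
- move=> _ _ [c ->] [d ->]; exists (fun i => c i + d i).
  by rewrite -big_split; apply: eq_bigr => i _; rewrite mulrDl.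
- move=> a _ [c ->]; exists (fun i => a * c i).
  by rewrite mulr_sumr; apply: eq_bigr => i _; rewrite mulrA.
Qed.

Lemma mem_ideal_gen s x : x \in s -> ideal_gen s x.
Proof.
move=> xs; have lt_xs : (index x s < size s)%N by rewrite index_mem.
exists (fun i => (i == Ordinal lt_xs)%:R).
rewrite (bigD1 (Ordinal lt_xs)) //= eqxx mul1r nth_index // big1 ?addr0 //.
by move=> i /negPf ->; rewrite mul0r.
Qed.

Lemma ideal_gen_sub (I : set A) s :
  is_ideal I -> (forall x, x \in s -> I x) -> ideal_gen s `<=` I.
Proof.
move=> [I0 ID IM] sI _ [c ->].
by elim/big_ind: _ => // i _; apply/IM/sI/mem_nth.
Qed.

End Ideals.

Section Spectrum.
Variable A : idomainType.

Record spec := Spec {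
  spec_pred : {pred A};
  spec_ideal : idealr_closed spec_pred;
  spec_prime : prime_idealr_closed spec_pred }.

HB.instance Definition _ := gen_eqMixin spec.
HB.instance Definition _ := gen_choiceMixin spec.

Fact zero_ideal_subproof : idealr_closed (pred1 (0 : A)).
Proof.
split; rewrite ?inE ?oner_neq0 // => a x y; rewrite !inE => /eqP-> /eqP->.
by rewrite mulr0 addr0.
Qed.

Fact zero_prime_subproof : prime_idealr_closed (pred1 (0 : A)).
Proof. by move=> x y; rewrite !inE mulf_eq0. Qed.

HB.instance Definition _ :=
  isPointed.Build spec (Spec zero_ideal_subproof zero_prime_subproof).

Definition spec_D (E : set A) : set spec :=
  [set p | ~ (E `<=` [set` spec_pred p])].

Definition zariski_open : set_system spec := [set U | exists E, U = spec_D E].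

Fact zariski_openT : zariski_open setT.
Proof.
exists [set 1]; apply/esym/seteqP; split=> // p _ /(_ 1 erefl) /=.
by case: (spec_ideal p) => _ /negP.
Qed.

Fact zariski_openI : setI_closed zariski_open.
Proof.
move=> _ _ [E ->] [F ->]; exists [set x * y | x in E & y in F].
apply/seteqP; split=> p /=.
- move=> [nE nF] EF; apply: nE => x Ex; apply: contrapT => /negP px.
  apply: nF => y Fy /=.
  have /(@spec_prime p) : x * y \in spec_pred p.
    by apply: (EF (x * y)); exists x => //; exists y.
  by rewrite (negPf px).
- have [p0 _ pM] := spec_ideal p.
  move=> nEF; split=> sub; apply: nEF => _ [x Ex [y Fy <-]] /=.
  + by rewrite mulrC -[_ * _]addr0; apply: pM => //; exact: (sub x Ex).
  + by rewrite -[_ * _]addr0; apply: pM => //; exact: (sub y Fy).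
Qed.

Fact zariski_open_bigU (I : Type) (f : I -> set spec) :
  (forall i, zariski_open (f i)) -> zariski_open (\bigcup_i f i).
Proof.
move=> /choice [E fE]; exists (\bigcup_i E i); apply/seteqP; split=> p.
- move=> [i _]; rewrite fE /= => nE sub; apply: nE => x Ex.
  by apply: sub; exists i.
- move=> nE; apply: contrapT => nf; apply: nE => x [i _ Eix].
  by apply: contrapT => px; apply: nf; exists i => //; rewrite fE => /(_ x Eix).
Qed.

HB.instance Definition _ := isOpenTopological.Build spec
  zariski_openT zariski_openI zariski_open_bigU.

(* [spec] again, as a carrier for the inverse topology. *)
Definition inverse_spec : Type := spec.

HB.instance Definition _ := Pointed.on inverse_spec.

Definition quasicompact_open : set_system spec :=
  [set U | open U /\ cover_compact U].

Fact quasicompact_openU : setU_closed quasicompact_open.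
Proof.
move=> U V [oU cU] [oV cV]; split; first exact: openU.
by move: cU cV; rewrite -compact_cover; exact: compactU.
Qed.

(* A basis of closed sets amounts to the basis of open sets consisting of the
   complements. *)
Fact inverse_cover : \bigcup_(U in quasicompact_open) ~` U = setT.
Proof.
apply/seteqP; split=> // p _; exists set0 => //; split; first exact: open0.
by rewrite -compact_cover; exact: compact0.
Qed.

Fact inverse_join (U V : set spec) (p : spec) :
  quasicompact_open U -> quasicompact_open V -> (~` U) p -> (~` V) p ->
  exists W, [/\ quasicompact_open W, (~` W) p & ~` W `<=` ~` U `&` ~` V].
Proof.
move=> oU oV Up Vp; exists (U `|` V); rewrite setCU; split=> //.
exact: quasicompact_openU.
Qed.

HB.instance Definition _ := @isBaseTopological.Build inverse_spec
  (set spec) quasicompact_open (@setC spec) inverse_cover inverse_join.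

Definition inverse_closure (Y : set spec) : set spec :=
  closure (Y : set inverse_spec).

End Spectrum.

Section Submodules.
Variable A : idomainType.
Local Notation K := {fraction A}.
Local Notation "x %:F" := (tofrac x) : ring_scope.

Definition is_submodule (F : set K) :=
  [/\ F 0, forall x y, F x -> F y -> F (x + y)
    & forall (a : A) x, F x -> F (a%:F * x)].

Record submodule := Submodule {
  submodule_set :> set K;
  submodule_submodule : is_submodule submodule_set;
  submodule_neq0 : exists2 x, submodule_set x & x != 0 }.

Lemma submodule_ext (F G : submodule) : F = G :> set K -> F = G.
Proof.
case: F G => [F hF nF] [G hG nG] /= eFG; subst G.
by congr Submodule; exact: Prop_irrelevance.
Qed.

Definition scale_set (k : K) (F : set K) : set K := [set k * x | x in F].

Fact scale_submodule_subproof (k : K) (F : submodule) :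
  is_submodule (scale_set k F).
Proof.
have [F0 FD FM] := submodule_submodule F; split.
- by exists 0; rewrite ?mulr0.
- by move=> _ _ [x Fx <-] [y Fy <-]; exists (x + y); rewrite ?mulrDr //; apply: FD.
- by move=> a _ [x Fx <-]; exists (a%:F * x); rewrite 1?mulrCA //; apply: FM.
Qed.

Fact scale_neq0_subproof (k : K) (k0 : k != 0) (F : submodule) :
  exists2 x, scale_set k F x & x != 0.
Proof.
have [x Fx x0] := submodule_neq0 F.
by exists (k * x); [exists x | rewrite mulf_neq0].
Qed.

Definition scale_submodule (k : K) (k0 : k != 0) (F : submodule) : submodule :=
  Submodule (scale_submodule_subproof k F) (scale_neq0_subproof k0 F).

Lemma tofrac_image_submodule (I : set A) :
  is_ideal I -> is_submodule [set x%:F | x in I].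
Proof.
move=> [I0 ID IM]; split.
- by exists 0; rewrite ?tofrac0.
- by move=> _ _ [x Ix <-] [y Iy <-]; exists (x + y); rewrite ?tofracD //; apply: ID.
- by move=> a _ [x Ix <-]; exists (a * x); rewrite ?tofracM //; apply: IM.
Qed.

Lemma tofrac_image_neq0 (I : set A) :
  (exists2 x, I x & x != 0) -> exists2 x, [set x%:F | x in I] x & x != 0.
Proof. by case=> x Ix x0; exists x%:F; [exists x | rewrite tofrac_eq0]. Qed.

Definition ideal_submodule (I : nzideal A) : submodule :=
  Submodule (tofrac_image_submodule (nzideal_ideal I))
            (tofrac_image_neq0 (nzideal_neq0 I)).

Fact whole_ideal_subproof : is_ideal [set: A]. Proof. by []. Qed.

Fact whole_neq0_subproof : exists2 x, [set: A] x & x != 0.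
Proof. by exists 1; rewrite ?oner_neq0. Qed.

Definition whole_ideal : nzideal A :=
  NzIdeal whole_ideal_subproof whole_neq0_subproof.

Definition base_submodule : submodule := ideal_submodule whole_ideal.

Record semistar := Semistar {
  semistar_map :> submodule -> submodule;
  semistar_scale : forall (k : K) (k0 : k != 0) (F : submodule),
    semistar_map (scale_submodule k0 F)
    = scale_submodule k0 (semistar_map F);
  semistar_mono : forall F G : submodule,
    F `<=` G -> semistar_map F `<=` semistar_map G;
  semistar_extensive : forall F : submodule, F `<=` semistar_map F;
  semistar_idem : forall F : submodule,
    semistar_map (semistar_map F) = semistar_map F }.

Lemma eq_semistar (s t : semistar) : s =1 t -> s = t.
Proof.
case: s t => [s s1 s2 s3 s4] [t t1 t2 t3 t4] /= /funext est; subst t.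
by congr Semistar; exact: Prop_irrelevance.
Qed.

Definition localization (p : spec A) : set K :=
  [set x | exists a s : A, s \notin spec_pred p /\ x = a%:F / s%:F].

Definition mul_set (F G : set K) : set K :=
  [set x | exists r : seq (K * K),
    (forall u, u \in r -> F u.1 /\ G u.2) /\ x = \sum_(u <- r) u.1 * u.2].

Lemma mul_setD F G x y :
  mul_set F G x -> mul_set F G y -> mul_set F G (x + y).
Proof.
move=> [r [rP ->]] [t [tP ->]]; exists (r ++ t); rewrite big_cat; split=> // u.
by rewrite mem_cat => /orP[/rP|/tP].
Qed.

Lemma mul_setM F G x y : F x -> G y -> mul_set F G (x * y).
Proof.
move=> Fx Gy; exists [:: (x, y)]; rewrite big_seq1; split=> // u.
by rewrite inE => /eqP ->.
Qed.

Lemma mul_set0 F G : mul_set F G 0.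
Proof. by exists [::]; rewrite big_nil. Qed.

Lemma mul_set_sub F G (H : set K) : H 0 ->
  (forall x y, H x -> H y -> H (x + y)) ->
  (forall x y, F x -> G y -> H (x * y)) -> mul_set F G `<=` H.
Proof.
move=> H0 HD HM _ [r [rP ->]].
by rewrite big_seq; elim/big_ind: _ => // u /rP[]; exact: HM.
Qed.

Lemma localization1 p : localization p 1.
Proof.
exists 1, 1; rewrite tofrac1 divr1; split=> //.
by have [] := spec_ideal p.
Qed.

Lemma localizationM p x y :
  localization p x -> localization p y -> localization p (x * y).
Proof.
move=> [a [s [ps ->]]] [b [t [pt ->]]]; exists (a * b), (s * t); split.
  by apply/negP => /(@spec_prime _ p); rewrite (negPf ps) (negPf pt).
by rewrite !tofracM mulf_div.
Qed.

Definition spectral_set (Y : set (spec A)) (F : set K) : set K :=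
  \bigcap_(p in Y) mul_set F (localization p).

Lemma sub_spectral_set Y F : F `<=` spectral_set Y F.
Proof.
by move=> x Fx p _; rewrite -[x]mulr1; apply: mul_setM => //; exact: localization1.
Qed.

Lemma spectral_set_mono Y F G : F `<=` G -> spectral_set Y F `<=` spectral_set Y G.
Proof.
move=> FG x + p Yp => /(_ p Yp); apply: mul_set_sub.
- exact: mul_set0.
- exact: mul_setD.
- by move=> y z /FG; exact: mul_setM.
Qed.

Fact spectral_submodule_subproof Y (F : submodule) :
  is_submodule (spectral_set Y F).
Proof.
have [F0 FD FM] := submodule_submodule F; split.
- by move=> p _; exact: mul_set0.
- by move=> x y Fx Fy p Yp; apply: mul_setD; [exact: Fx | exact: Fy].
- move=> a x + p Yp => /(_ p Yp).
  apply: (mul_set_sub (H := [set x | mul_set F (localization p) (a%:F * x)])).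
  + by rewrite /= mulr0; exact: mul_set0.
  + by move=> y z /= Fy Fz; rewrite mulrDr; exact: mul_setD.
  + by move=> y z Fy pz /=; rewrite mulrA; apply: mul_setM => //; exact: FM.
Qed.

Fact spectral_neq0_subproof Y (F : submodule) :
  exists2 x, spectral_set Y F x & x != 0.
Proof.
by have [x Fx x0] := submodule_neq0 F; exists x => //; exact: sub_spectral_set.
Qed.

Definition spectral_map Y (F : submodule) : submodule :=
  Submodule (spectral_submodule_subproof Y F) (spectral_neq0_subproof Y F).

Fact spectral_scale_subproof Y (k : K) (k0 : k != 0) F :
  spectral_map Y (scale_submodule k0 F) = scale_submodule k0 (spectral_map Y F).
Proof.
have scaleE (l : K) (G : set K) p x : mul_set G (localization p) x ->
    mul_set (scale_set l G) (localization p) (l * x).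
  move: x; apply: (mul_set_sub
    (H := [set x | mul_set (scale_set l G) (localization p) (l * x)])) => /=.
  - by rewrite mulr0; exact: mul_set0.
  - by move=> x y Hx Hy; rewrite mulrDr; exact: mul_setD.
  - by move=> x y Gx py; rewrite mulrA; apply: mul_setM => //; exists x.
apply: submodule_ext; apply/seteqP; split=> x.
- move=> kFx; exists (k^-1 * x); last by rewrite mulVKf.
  move=> p Yp; have /(scaleE k^-1) := kFx p Yp.
  apply: mul_set_sub; [exact: mul_set0 | exact: mul_setD |].
  by move=> _ z [_ [y Fy <-] <-] pz; rewrite mulKf //; exact: mul_setM.
- by move=> [y Fy <-] p Yp; apply/scaleE/Fy.
Qed.

Fact spectral_idem_subproof Y F : spectral_map Y (spectral_map Y F) = spectral_map Y F.
Proof.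
apply: submodule_ext; apply/seteqP; split; last exact: sub_spectral_set.
move=> x + p Yp => /(_ p Yp).
apply: mul_set_sub; [exact: mul_set0 | exact: mul_setD |].
move=> y z /(_ p Yp) + pz; move: y.
apply: (mul_set_sub (H := [set y | mul_set F (localization p) (y * z)])) => /=.
- by rewrite mul0r; exact: mul_set0.
- by move=> u v Hu Hv; rewrite mulrDl; exact: mul_setD.
- by move=> u v Fu pv; rewrite -mulrA; apply: mul_setM => //; exact: localizationM.
Qed.

Definition spectral (Y : set (spec A)) : semistar :=
  Semistar (semistar_map := spectral_map Y)
    (spectral_scale_subproof Y)
    (fun F G FG => spectral_set_mono (Y := Y) FG)
    (fun F => sub_spectral_set (Y := Y) (F := F))
    (spectral_idem_subproof Y).

Definition colon (F : set K) (I : set A) : set K :=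
  [set x | forall a, I a -> F (x * a%:F)].

Definition stable_set (star : semistar) (F : set K) : set K :=
  [set x | exists I : nzideal A,
    [/\ fg_ideal I,
        star (ideal_submodule I) = star base_submodule
      & colon F I x]].

Section StableClosure.
Variable star : semistar.

Let dense (I : nzideal A) :=
  fg_ideal I /\ star (ideal_submodule I) = star base_submodule.

Let dense_whole : dense whole_ideal.
Proof.
split=> //; exists [:: 1]; apply/esym/seteqP; split=> // x _ /=.
by exists (fun=> x); rewrite big_ord1 mulr1.
Qed.

Let base_sub_star (I : nzideal A) : dense I ->
  base_submodule `<=` star (ideal_submodule I).
Proof. by case=> _ ->; exact: semistar_extensive. Qed.

Lemma dense_mul (s t : seq A) (I J : nzideal A) :
  dense I -> dense J -> I = ideal_gen s :> set A -> J = ideal_gen t :> set A ->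
  exists2 L : nzideal A, dense L &
    L = ideal_gen [seq x * y | x <- s, y <- t] :> set A.
Proof.
move=> dI dJ Is Jt; pose L := ideal_gen [seq x * y | x <- s, y <- t].
have iL : is_ideal L := ideal_gen_ideal _.
have ML x y : nzideal_set I x -> nzideal_set J y -> L (x * y).
  rewrite Is Jt => + ty; move: x.
  apply: (ideal_gen_sub (I := [set x | L (x * y)])).
    case: iL => L0 LD LM; split=> /=; first by rewrite mul0r.
      by move=> a b La Lb; rewrite mulrDl; exact: LD.
    by move=> a b Lb; rewrite -mulrA; exact: LM.
  move=> x sx /=; move: y ty.
  apply: (ideal_gen_sub (I := [set y | L (x * y)])).
    case: iL => L0 LD LM; split=> /=; first by rewrite mulr0.
      by move=> a b La Lb; rewrite mulrDr; exact: LD.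
    by move=> a b Lb; rewrite mulrCA; exact: LM.
  by move=> y ty; apply/mem_ideal_gen/allpairs_f.
have L0 : exists2 x, L x & x != 0.
  have [x Ix x0] := nzideal_neq0 I; have [y Jy y0] := nzideal_neq0 J.
  by exists (x * y); [exact: ML | rewrite mulf_neq0].
pose LL := NzIdeal iL L0; exists LL => //; split; first by eexists; reflexivity.
apply: submodule_ext; apply/seteqP; split.
  by apply: semistar_mono => _ [x _ <-]; exists x.
rewrite -[star (ideal_submodule LL)]semistar_idem; apply: semistar_mono.
apply: subset_trans (base_sub_star dI) _.
rewrite -[star (ideal_submodule LL)]semistar_idem; apply: semistar_mono.
move=> _ [x Ix <-]; have [->|x0] := eqVneq x 0.
  by rewrite tofrac0; have [] := submodule_submodule (star (ideal_submodule LL)).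
have xF0 : x%:F != 0 :> K by rewrite tofrac_eq0.
have sub : scale_submodule xF0 (ideal_submodule J) `<=` ideal_submodule LL.
  by move=> _ [_ [y Jy <-] <-]; exists (x * y); [exact: ML | rewrite tofracM].
apply: (semistar_mono sub); rewrite semistar_scale.
exists 1; last by rewrite mulr1.
by apply: (base_sub_star dJ); exists 1; rewrite ?tofrac1.
Qed.

Lemma dense_cap (I J : nzideal A) : dense I -> dense J ->
  exists L : nzideal A, [/\ dense L, L `<=` I & L `<=` J].
Proof.
move=> dI dJ; have [[s Is] _] := dI; have [[t Jt] _] := dJ.
have [L dL LE] := dense_mul dI dJ Is Jt; exists L; rewrite LE; split=> //.
- apply: ideal_gen_sub; first exact: nzideal_ideal.
  move=> _ /allpairsP[[x y] [sx ty ->]] /=; rewrite mulrC.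
  by have [_ _] := nzideal_ideal I; apply; rewrite Is; exact: mem_ideal_gen.
- apply: ideal_gen_sub; first exact: nzideal_ideal.
  move=> _ /allpairsP[[x y] [sx ty ->]] /=.
  by have [_ _] := nzideal_ideal J; apply; rewrite Jt; exact: mem_ideal_gen.
Qed.

Lemma colon_ideal (F : submodule) (x : K) : is_ideal [set a | submodule_set F (x * a%:F)].
Proof.
have [F0 FD FM] := submodule_submodule F; split=> /=.
- by rewrite tofrac0 mulr0.
- by move=> a b Fa Fb; rewrite tofracD mulrDr; exact: FD.
- by move=> a b Fb; rewrite tofracM mulrCA; exact: FM.
Qed.

Lemma sub_stable_set (F : submodule) : F `<=` stable_set star F.
Proof.
move=> x Fx; exists whole_ideal; case: dense_whole => fg eq; split=> // a _.
by rewrite mulrC; have [_ _] := submodule_submodule F; apply.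
Qed.

Lemma stable_set_mono (F G : set K) :
  F `<=` G -> stable_set star F `<=` stable_set star G.
Proof. by move=> FG x [I [fg eq FI]]; exists I; split=> // a /FI /FG. Qed.

Fact stable_submodule_subproof (F : submodule) : is_submodule (stable_set star F).
Proof.
have [F0 FD FM] := submodule_submodule F; split.
- exact: sub_stable_set.
- move=> x y [I [fgI eqI FI]] [J [fgJ eqJ FJ]].
  have [L [[fgL eqL] LI LJ]] := dense_cap (conj fgI eqI) (conj fgJ eqJ).
  by exists L; split=> // a La; rewrite mulrDl; apply: FD; [exact/FI/LI | exact/FJ/LJ].
- move=> a x [I [fgI eqI FI]]; exists I; split=> // b Ib.
  by rewrite -mulrA; apply/FM/FI.
Qed.

Fact stable_neq0_subproof (F : submodule) :
  exists2 x, stable_set star F x & x != 0.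
Proof.
by have [x Fx x0] := submodule_neq0 F; exists x => //; exact: sub_stable_set.
Qed.

Definition stable_map (F : submodule) : submodule :=
  Submodule (stable_submodule_subproof F) (stable_neq0_subproof F).

Fact stable_scale_subproof (k : K) (k0 : k != 0) (F : submodule) :
  stable_map (scale_submodule k0 F) = scale_submodule k0 (stable_map F).
Proof.
apply: submodule_ext; apply/seteqP; split=> x.
- move=> [I [fg eq FI]]; exists (k^-1 * x); last by rewrite mulVKf.
  exists I; split=> // a /FI [y Fy /esym e].
  by rewrite -mulrA e mulKf.
- move=> [y [I [fg eq FI]] <-]; exists I; split=> // a /FI Fya.
  by exists (y * a%:F); rewrite ?mulrA.
Qed.

Fact stable_idem_subproof (F : submodule) :
  stable_map (stable_map F) = stable_map F.
Proof.
apply: submodule_ext; apply/seteqP; split; last exact: sub_stable_set.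
move=> x [I [fgI eqI FI]]; have [s Is] := fgI.
have [J dJ FJ] : exists2 J : nzideal A, dense J &
    forall a b, a \in s -> nzideal_set J b -> submodule_set F (x * a%:F * b%:F).
  have : forall a, a \in s -> stable_set star F (x * a%:F).
    by move=> a sa; apply: FI; rewrite Is; exact: mem_ideal_gen.
  elim: (s) => [|a r IHr] FR; first by exists whole_ideal.
  have [J dJ FJ] : exists2 J : nzideal A, dense J &
      forall a b, a \in r -> nzideal_set J b -> submodule_set F (x * a%:F * b%:F).
    by apply: IHr => b rb; apply: FR; rewrite inE rb orbT.
  have [J' [fgJ' eqJ' FJ']] := FR a (mem_head _ _).
  have [L [dL LJ LJ']] := dense_cap dJ (conj fgJ' eqJ').
  exists L => // b c; rewrite inE => /predU1P[->|rb] Lc.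
    exact/FJ'/LJ'.
  exact/FJ/LJ.
have [[t Jt] _] := dJ.
have [L [fgL eqL] LE] := dense_mul (conj fgI eqI) dJ Is Jt.
exists L; split=> //; rewrite LE.
apply: (ideal_gen_sub (colon_ideal F x)) => _ /allpairsP[[a b] [sa tb ->]] /=.
by rewrite tofracM mulrA; apply: FJ => //; rewrite Jt; exact: mem_ideal_gen.
Qed.

Definition stable_closure : semistar :=
  Semistar (semistar_map := stable_map)
    stable_scale_subproof
    (fun F G FG => stable_set_mono FG)
    sub_stable_set
    stable_idem_subproof.

End StableClosure.

Definition weakly_equivalent (star1 star2 : semistar) :=
  stable_closure star1 = stable_closure star2.

End Submodules.

(* Main.v *)
Require Import Defs.
From HB Require Import structures.
From mathcomp Require Import all_boot all_order all_algebra.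
From mathcomp Require Import all_classical topology.
From mathcomp Require Import finmap.
Local Open Scope classical_set_scope.

(** All three conditions are controlled by one datum: the finitely generated
    ideals [a] with [Y `<=` spec_D a].

    On the topological side, these [spec_D a] are exactly the quasi-compact
    Zariski open sets ([quasicompact_openP]), hence the basic closed sets of
    the inverse topology.  The inverse closure of [Y] is therefore the
    intersection of the [spec_D a] containing [Y] ([inverse_closureP]), and the
    closure of [Y] and the family of all such [a] determine each other
    ([eq_inverse_closureP]).  Quasi-compactness of [spec_D a] rests on the
    existence of primes disjoint from a multiplicative set
    ([exists_prime_avoiding]).

    On the semistar side, for a nonzero ideal [I] the equality of the
    [spectral Y]-closures of [I] and [A] means that [1] lies in every [I A_p]
    with [p] in [Y], that is, that [I] is contained in no prime of [Y]
    ([spectral_denseP]).  So the stable closure of [spectral Y] is computed by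
    the same ideals [a].  It remembers which ones they are: [Y `<=` spec_D a]
    exactly when [1] is in the stable closure of [a], because then [a] contains
    an ideal [J] with [Y `<=` spec_D J] ([stable_spectral1P]).  This gives
    [weakly_equivalent_spectralP]. *)

(** * Primes disjoint from a multiplicative set *)

Section PrimeAvoidance.
Set Implicit Arguments.
Unset Strict Implicit.
Import GRing.Theory.
Local Open Scope ring_scope.
Variable A : idomainType.

Lemma spec_is_ideal (p : spec A) : is_ideal [set` spec_pred p].
Proof.
have [p0 _ pM] := spec_ideal p; split=> //= [x y px py|a x px].
  by rewrite -[x]mul1r; exact: pM.
by rewrite -[a * x]addr0; exact: pM.
Qed.

Lemma spec_notin_neq0 (p : spec A) (s : A) : s \notin spec_pred p -> s != 0.
Proof. by apply: contraNneq => ->; have [] := spec_ideal p. Qed.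

Lemma spec_notinM (p : spec A) (s t : A) :
  s \notin spec_pred p -> t \notin spec_pred p -> s * t \notin spec_pred p.
Proof.
by move=> ps pt; apply/negP => /(@spec_prime _ p); rewrite (negPf ps) (negPf pt).
Qed.

Lemma ideal_adjoin (I : set A) (a : A) :
  is_ideal I -> is_ideal [set x | exists2 u, I u & exists c, x = u + c * a].
Proof.
move=> [I0 ID IM]; split=> /=.
- by exists 0 => //; exists 0; rewrite mul0r addr0.
- move=> _ _ [u Iu [c ->]] [v Iv [d ->]].
  by exists (u + v); [exact: ID | exists (c + d); rewrite mulrDl addrACA].
- move=> b _ [u Iu [c ->]].
  by exists (b * u); [exact: IM | exists (b * c); rewrite mulrDr mulrA].
Qed.

(** An ideal [P] maximal among those containing [J] and disjoint from [S] is
    prime: if [a] and [b] are outside [P], then by maximality the ideals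
    [P + (a)] and [P + (b)] both meet [S], so [P + (a * b)] does too, and
    [a * b] is not in [P]. *)
Lemma exists_prime_avoiding (J S : set A) : is_ideal J -> S 1 ->
  (forall x y, S x -> S y -> S (x * y)) -> J `&` S = set0 ->
  exists p : spec A, J `<=` [set` spec_pred p] /\ [set` spec_pred p] `&` S = set0.
Proof.
move=> iJ S1 SM JS.
pose good X := [/\ is_ideal X, J `<=` X & X `&` S = set0].
(* The union of the empty chain is empty and so no ideal: [set0] is added to
   the ordered family as a spurious bottom, which [J] shows not to be maximal. *)
have [|P [Pgood Pmax]] := @Zorn_bigcup A (fun X => X = set0 \/ good X).
  move=> F FP Ftot.
  have Fgood X x : F X -> X x -> good X.
    by move=> FX Xx; case: (FP X FX) => // X0; rewrite X0 in Xx.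
  have [->|/set0P[x0 [X0 FX0 X0x0]]] := eqVneq (\bigcup_(X in F) X) set0.
    by left.
  right; have [[X00 _ _] JX0 _] := Fgood _ _ FX0 X0x0; split.
  - split; first by exists X0.
    + move=> x y [X FX Xx] [X' FX' X'y].
      have [XX'|X'X] := Ftot X X' FX FX'.
        have [[_ XD _] _ _] := Fgood _ _ FX' X'y.
        by exists X' => //; apply: XD => //; exact: XX'.
      have [[_ XD _] _ _] := Fgood _ _ FX Xx.
      by exists X => //; apply: XD => //; exact: X'X.
    + move=> a x [X FX Xx]; have [[_ _ XM] _ _] := Fgood _ _ FX Xx.
      by exists X => //; exact: XM.
  - by move=> x Jx; exists X0 => //; exact: JX0.
  - apply/seteqP; split=> // x [[X FX Xx] Sx].
    by have [_ _ <-] := Fgood _ _ FX Xx.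
have {Pgood} [iP JP PS] : good P.
  case: Pgood => // P0; exfalso; apply: (Pmax J); last by right; split.
  by rewrite P0; split=> // J0; case: iJ => /J0.
have [P0 PD PM] := iP.
have PNS x : P x -> S x -> False by move=> Px Sx; have : (P `&` S) x by []; rewrite PS.
have grow a : ~ P a -> exists u c, P u /\ S (u + c * a).
  move=> Pa; pose Q := [set x | exists2 u, P u & exists c, x = u + c * a].
  have PQ : P `<=` Q by move=> x Px; exists x => //; exists 0; rewrite mul0r addr0.
  have Qa : Q a by exists 0 => //; exists 1; rewrite add0r mul1r.
  apply: contrapT => nS; apply: (Pmax Q).
    by split=> // /(_ a Qa).
  right; split; [exact: ideal_adjoin | exact: subset_trans PQ |].
  apply/seteqP; split=> // _ [[u Pu [c ->]] Sx].
  by apply: nS; exists u, c.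
have Pid : idealr_closed [pred x | `[< P x >]].
  split=> [||a x y]; rewrite ?inE; first exact/asboolP.
    by apply/asboolP => P1; exact: PNS P1 S1.
  by move=> /asboolP Px /asboolP Py; apply/asboolP/PD => //; exact: PM.
have Ppr : prime_idealr_closed [pred x | `[< P x >]].
  move=> a b; rewrite !inE => /asboolP Pab; apply/orP.
  have [Pa|/grow[u [c [Pu Suc]]]] := pselect (P a); first by left; exact/asboolP.
  have [Pb|/grow[v [d [Pv Svd]]]] := pselect (P b); first by right; exact/asboolP.
  exfalso; apply: PNS (SM _ _ Suc Svd).
  rewrite mulrDl; apply: (PD); first by rewrite mulrC; exact: PM.
  rewrite mulrDr; apply: (PD); first exact: PM.
  by rewrite mulrACA; exact: PM.
exists (Spec Pid Ppr); split=> [x Jx /=|]; first exact/asboolP/JP.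
by apply/seteqP; split=> // x [/asboolP Px Sx]; exact: PNS Px Sx.
Qed.

End PrimeAvoidance.

(** * Quasi-compact open sets and the inverse closure *)

Section QuasiCompactOpens.
Set Implicit Arguments.
Unset Strict Implicit.
Import GRing.Theory.
Local Open Scope ring_scope.
Variable A : idomainType.
Implicit Types (Y : set (spec A)) (p : spec A).

Lemma spec_D1 (x : A) p : spec_D [set x] p <-> x \notin spec_pred p.
Proof.
split=> [nx|/negP nx sub]; last by apply: nx; exact: (sub x).
by apply/negP => px; apply: nx => _ ->.
Qed.

Lemma spec_DE (E : set A) : spec_D E = \bigcup_(x in E) spec_D [set x].
Proof.
apply/seteqP; split=> p.
  move=> /existsNP[x /not_implyP[Ex /negP px]]; exists x => //; exact/spec_D1.
by move=> [x Ex /spec_D1/negP px] sub; apply: px; exact: (sub x Ex).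
Qed.

Lemma spec_D_gen (s : seq A) : spec_D (ideal_gen s) = spec_D [set` s].
Proof.
apply/seteqP; split=> p nsub sub; apply: nsub.
  by apply: ideal_gen_sub; [exact: spec_is_ideal | exact: sub].
by move=> x /mem_ideal_gen; exact: sub.
Qed.

Lemma spec_D_ex (E : set A) p :
  spec_D E p -> exists2 x, E x & x \notin spec_pred p.
Proof. by rewrite spec_DE => -[x Ex /spec_D1]; exists x. Qed.

(** The elements [a] for which finitely many members of the covering cover
    [spec_D [set a]] form an ideal [J], which is radical because a prime avoids
    [a] iff it avoids its powers.  A prime containing [J] lies in no member
    [spec_D E] of the covering, as [E] is contained in [J].  Were [x] outside
    [J], there would be such a prime avoiding the powers of [x], hence a point
    of [spec_D [set x]] that is not covered. *)
Lemma quasicompact_spec_D1 (x : A) : cover_compact (spec_D [set x]).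
Proof.
move=> I D f fo xD.
pose J := [set a | exists2 D' : {fset I}, {subset D' <= D} &
  spec_D [set a] `<=` cover [set` D'] f].
suff : J x by case=> D' D'D xD'; exists D'.
have iJ : is_ideal J.
  split.
  - exists fset0 => // p /spec_D1; have [-> _ _] := spec_is_ideal p.
    by [].
  - move=> a b [Da DaD aDa] [Db DbD bDb]; exists (Da `|` Db)%fset.
      by move=> i; rewrite in_fsetU => /orP[/DaD|/DbD].
    move=> p /spec_D1 pab.
    have [/spec_D1/aDa[i /= iDa fi]|/negPn pa] :=
      boolP (a \notin spec_pred p).
      by exists i => //=; rewrite in_fsetU iDa.
    have [/spec_D1/bDb[i /= iDb fi]|/negPn pb] :=
      boolP (b \notin spec_pred p).
      by exists i => //=; rewrite in_fsetU iDb orbT.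
    by have [_ pD _] := spec_is_ideal p; move/negP: pab; case; exact: pD.
  - move=> c a [Da DaD aDa]; exists Da => // p /spec_D1 pca; apply/aDa/spec_D1.
    apply: contra pca => pa; have [_ _ pM] := spec_is_ideal p; exact: pM.
apply: contrapT => nJx.
have [|||p [Jp pS]] := @exists_prime_avoiding A J [set y | exists n, y = x ^+ n] iJ.
- by exists 0%N; rewrite expr0.
- by move=> _ _ [m ->] [n ->]; exists (m + n)%N; rewrite exprD.
- apply/seteqP; split=> // y [[D' D'D D'y] [n yn]]; apply: nJx; exists D' => //.
  move=> p /spec_D1 px; apply/D'y/spec_D1; rewrite yn.
  elim: n {yn} => [|n IHn]; first by have [] := spec_ideal p.
  by rewrite exprS; exact: spec_notinM.
have px : x \notin spec_pred p.
  apply/negP => px; have : ([set` spec_pred p] `&` [set y | exists n, y = x ^+ n]) x.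
    by split=> //; exists 1%N; rewrite expr1.
  by rewrite pS.
have [i Di fi] := xD p (iffRL (spec_D1 _ _) px).
have [E fE] : zariski_open (f i) := fo i Di.
move: fi; rewrite fE; apply; apply: subset_trans Jp => y Ey.
exists [fset i]%fset; first by move=> j; rewrite in_fset1 => /eqP ->; exact: mem_set.
move=> q /spec_D1/negP qy; exists i; rewrite /= ?inE // fE => sub.
by apply: qy; exact: (sub y Ey).
Qed.

(** An open [spec_D E] is covered by the [spec_D [set x]] with [x] in [E], and
    generators of [a] are the indices of a finite subcover.  Conversely, a finite
    union of quasi-compact sets is quasi-compact. *)
Lemma quasicompact_openP (U : set (spec A)) :
  quasicompact_open U <-> exists2 a : set A, fg_ideal a & U = spec_D a.
Proof.
split=> [[[E UE] cU]|[_ [s ->] ->]].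
  have [||D' D'E UD'] := cU A E (fun x => spec_D [set x]).
  - by move=> x _; exists [set x].
  - by rewrite UE spec_DE.
  exists (ideal_gen D'); first by exists D'.
  rewrite spec_D_gen spec_DE; apply/seteqP; split=> // p [x D'x px].
  rewrite UE spec_DE; exists x => //; exact: set_mem (D'E x D'x).
split; first by exists (ideal_gen s).
rewrite spec_D_gen; elim: s => [|x s IHs].
  rewrite spec_DE; have -> : [set` [::]] = set0 :> set A by apply/seteqP; split.
  by rewrite bigcup_set0 -compact_cover; exact: compact0.
have -> : spec_D [set` x :: s] = spec_D [set x] `|` spec_D [set` s].
  have -> : [set` x :: s] = x |` [set` s].
    by apply/seteqP; split=> y /=; rewrite inE => /predU1P.
  by rewrite spec_DE bigcup_setU1 -spec_DE.
move: IHs (@quasicompact_spec_D1 x); rewrite -compact_cover => cs cx.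
exact: compactU.
Qed.

Lemma inverse_closureP Y p : inverse_closure Y p <->
  forall a : set A, fg_ideal a -> Y `<=` spec_D a -> spec_D a p.
Proof.
split=> [clYp a fga Ya|dY B].
  apply: contrapT => nap.
  have oC : @open (inverse_spec A) (~` spec_D a).
    exists [set spec_D a]; last by rewrite bigcup_set1.
    by move=> _ ->; apply/quasicompact_openP; exists a.
  have /clYp[q [Yq]] : nbhs (p : inverse_spec A) (~` spec_D a).
    exact: open_nbhs_nbhs.
  by apply; exact: Ya.
rewrite nbhsE => -[V [[V' V'qc <-] [U V'U nUp]] VB].
have [a fga Ua] := iffLR (quasicompact_openP U) (V'qc U V'U).
apply: contrapT => YB; apply: nUp; rewrite Ua; apply: dY => //.
rewrite -Ua => q Yq; apply: contrapT => nUq; apply: YB; exists q; split=> //.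
by apply: VB; exists U.
Qed.

(** A set and its inverse closure are contained in the same [spec_D a] with [a]
    finitely generated, since those are closed for the inverse topology. *)
Lemma eq_inverse_closureP Y Z : inverse_closure Y = inverse_closure Z <->
  forall a : set A, fg_ideal a -> (Y `<=` spec_D a <-> Z `<=` spec_D a).
Proof.
have sub X (a : set A) : fg_ideal a -> X `<=` spec_D a <-> inverse_closure X `<=` spec_D a.
  move=> fga; split=> [Xa p /inverse_closureP/(_ a fga)|clXa p Xp]; first exact.
  by apply: clXa; apply/inverse_closureP => b _ /(_ p Xp).
split=> [YZ a fga|YZ]; first by rewrite (sub Y) // YZ -sub.
by apply/seteqP; split=> p /inverse_closureP clp; apply/inverse_closureP => a fga;
  move/(YZ a fga); exact: clp.
Qed.

End QuasiCompactOpens.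

(** * The stable closure of a spectral semistar operation *)

Section StableClosureOfSpectral.
Set Implicit Arguments.
Unset Strict Implicit.
Import GRing.Theory.
Local Open Scope ring_scope.
Variable A : idomainType.
Implicit Types (Y Z : set (spec A)) (I : nzideal A).

(** Elements of [I A_p] are a priori sums of products; a common denominator
    turns them into single fractions. *)
Lemma mul_localizationP I (p : spec A) x :
  mul_set (ideal_submodule I) (localization p) x ->
  exists a s, [/\ nzideal_set I a, s \notin spec_pred p & x = tofrac a / tofrac s].
Proof.
have [I0 ID IM] := nzideal_ideal I.
have p1 : 1 \notin spec_pred p by have [] := spec_ideal p.
have p0 s : s \notin spec_pred p -> tofrac s != 0.
  by rewrite tofrac_eq0; exact: spec_notin_neq0.
move: x; apply: (mul_set_sub (H := [set x | exists a s,
  [/\ nzideal_set I a, s \notin spec_pred p & x = tofrac a / tofrac s]])) => /=.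
- by exists 0, 1; rewrite tofrac0 mul0r.
- move=> _ _ [a [s [Ia ps ->]]] [b [t [Ib pt ->]]].
  exists (a * t + b * s), (s * t); split; last 1 first.
  + by rewrite addf_div ?p0 // tofracD !tofracM.
  + by apply: ID; rewrite mulrC; exact: IM.
  + exact: spec_notinM.
- move=> _ _ [a Ia <-] [b [s [ps ->]]]; exists (b * a), s; split=> //.
    exact: IM.
  by rewrite mulrA -tofracM [a * b]mulrC.
Qed.

(** If [I] is inside some [p] in [Y], a fraction of [I A_p] equal to [1] would
    have its denominator in [I], hence in [p].  If [s] is in [I] but not in
    [p], then every [x] in [A] is the element [s * (x / s)] of [I A_p]. *)
Lemma spectral_denseP Y I :
  spectral Y (ideal_submodule I) = spectral Y (base_submodule A) <-> Y `<=` spec_D I.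
Proof.
split=> [dI p Yp Ip|YI].
  have : submodule_set (spectral Y (base_submodule A)) 1.
    by apply: semistar_extensive; exists 1; rewrite ?tofrac1.
  rewrite -dI => /(_ p Yp)/mul_localizationP[a [s [Ia ps e]]].
  have s0 : tofrac s != 0 by rewrite tofrac_eq0; exact: spec_notin_neq0 ps.
  have /eqP : tofrac a = tofrac s by rewrite -[RHS]mul1r e divfK.
  by rewrite tofrac_eq => /eqP eas; move/negP: ps; apply; rewrite -eas; exact: Ip.
apply: submodule_ext; apply/seteqP; split.
  by apply: semistar_mono => _ [x _ <-]; exists x.
rewrite -[spectral Y (ideal_submodule I)]semistar_idem; apply: semistar_mono.
move=> _ [x _ <-] p Yp.
have [s Is ps] := spec_D_ex (YI p Yp).
have s0 : tofrac s != 0 by rewrite tofrac_eq0; exact: spec_notin_neq0 ps.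
rewrite -(divfK s0 (tofrac x)) mulrC; apply: mul_setM; first by exists s.
by exists x, s.
Qed.

Lemma stable_spectralP Y (F : submodule A) x :
  submodule_set (stable_closure (spectral Y) F) x <->
  exists I, [/\ fg_ideal I, Y `<=` spec_D I & colon F I x].
Proof. by split=> -[I [fgI /spectral_denseP]]; exists I. Qed.

(** How the stable closure remembers the ideals that define it: on the ideals
    themselves, membership of [1] is a statement about [spec_D]. *)
Lemma stable_spectral1P Y I :
  submodule_set (stable_closure (spectral Y) (ideal_submodule I)) 1 <->
  exists J : nzideal A, [/\ fg_ideal J, Y `<=` spec_D J & J `<=` I].
Proof.
split=> [/stable_spectralP|] [J [fgJ YJ JI]]; last first.
  apply/stable_spectralP; exists J; split=> // a Ja.
  by rewrite mul1r; exists a => //; exact: JI.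
exists J; split=> // a /JI; rewrite mul1r => -[b Ib /eqP].
by rewrite tofrac_eq => /eqP <-.
Qed.

(** The stable closure quantifies over nonzero ideals only; a nonempty [Y]
    supplies a prime that [a] is not contained in, so [a] is nonzero. *)
Lemma nzideal_of_spec_D Y (a : set A) : Y !=set0 -> fg_ideal a -> Y `<=` spec_D a ->
  exists I, I = a :> set A.
Proof.
move=> [p Yp] [s ->] Ya.
suff n0 : exists2 x, ideal_gen s x & x != 0 by exists (NzIdeal (ideal_gen_ideal s) n0).
have [x ax px] := spec_D_ex (Ya p Yp).
by exists x => //; exact: spec_notin_neq0 px.
Qed.

Lemma weakly_equivalent_spectralP Y Z : Y !=set0 -> Z !=set0 ->
  weakly_equivalent (spectral Y) (spectral Z) <->
  forall a : set A, fg_ideal a -> (Y `<=` spec_D a <-> Z `<=` spec_D a).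
Proof.
have transfer X X' (a : set A) : X !=set0 ->
    stable_closure (spectral X) = stable_closure (spectral X') ->
    fg_ideal a -> X `<=` spec_D a -> X' `<=` spec_D a.
  move=> X0 XX' fga Xa; have [I aI] := nzideal_of_spec_D X0 fga Xa.
  have : submodule_set (stable_closure (spectral X) (ideal_submodule I)) 1.
    by apply/stable_spectral1P; exists I; rewrite aI; split.
  rewrite XX' => /stable_spectral1P[J [_ X'J]]; rewrite aI => JA p X'p ap.
  exact: (X'J p X'p (subset_trans JA ap)).
move=> Y0 Z0; split=> [YZ a fga|YZ].
  by split; apply: transfer.
apply: eq_semistar => F; apply: submodule_ext; apply/seteqP.
by split=> x /stable_spectralP[I [fgI /(YZ I fgI) ZI FI]];
  apply/stable_spectralP; exists I.
Qed.

End StableClosureOfSpectral.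

Theorem proposition5p1 (A : idomainType) (Y Z : set (spec A))
    (Y0 : Y !=set0) (Z0 : Z !=set0) :
  (weakly_equivalent (spectral Y) (spectral Z)
    <-> inverse_closure Y = inverse_closure Z)
  /\ (inverse_closure Y = inverse_closure Z
    <-> forall a : set A, fg_ideal a ->
          (Y `<=` spec_D a <-> Z `<=` spec_D a)).
Proof.
split; last exact: eq_inverse_closureP.
by rewrite eq_inverse_closureP; exact: weakly_equivalent_spectralP.
Qed.
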